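(* Let $n\ge2$ and $p^*=\binom{n}{\lfloor n/3\rfloor}\left(2^{\,n-\lfloor n/3\rfloor-1}-1\right)$. There is a set $\Sigma$ of $n\times n$ stochastic matrices such that: (i) there is a product $P$ of $p^*$ matrices from $\Sigma$ whose powers $P^k$ do not converge (as $k\to\infty$) to a rank one matrix; and (ii) for every product $P$ of at most $p^*-1$ matrices from $\Sigma$, the sequence of powers $P^k$ converges as $k\to\infty$ to a rank one matrix.
   Context: A matrix is stochastic if it is nonnegative and each row sums to one. *)

(* Defs.v *)
From HB Require Import structures.
From mathcomp Require Import all_boot all_order all_algebra.
From mathcomp Require Import all_classical all_reals all_analysis.
Set Implicit Arguments. Unset Strict Implicit. Unset Printing Implicit Defensive.
Import Order.TTheory GRing.Theory Num.Theory.
Import numFieldNormedType.Exports.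
Local Open Scope classical_set_scope.
Local Open Scope ring_scope.

Definition stochastic (R : numDomainType) (n : nat) (A : 'M[R]_n) : Prop :=
  (forall i j, 0 <= A i j) /\ (forall i, \sum_(j < n) A i j = 1).

Definition mxprod (R : numDomainType) (n : nat) (s : seq 'M[R]_n) : 'M[R]_n :=
  foldr (fun A B => A *m B) 1%:M s.

Definition mxpow (R : numDomainType) (n : nat) (P : 'M[R]_n) (k : nat) : 'M[R]_n :=
  iter k (fun B => P *m B) 1%:M.

Definition powers_converge_rank_one (R : realType) (n : nat) (P : 'M[R]_n) : Prop :=
  exists L : 'M[R]_n, \rank L = 1%N /\
    forall i j, (fun k : nat => mxpow P k i j) @ \oo --> L i j.

Definition pstar (n : nat) : nat :=
  ('C(n, n %/ 3) * (2 ^ (n - n %/ 3 - 1) - 1))%N.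

(* Main.v *)
(* Enumerate as c_0, ..., c_(p-1), with p = p*, the unordered pairs {A, B} of
   disjoint nonempty sets of states such that A :|: B has n - n/3 elements, and
   let M_t map A_t uniformly onto A_(t+1), B_t uniformly onto B_(t+1) (indices
   mod p) and every other state uniformly onto all the states.  The product
   M_0 ... M_(p-1) keeps A_0 and B_0 closed, so its powers cannot converge to a
   rank one matrix.  Conversely, if two rows of a product of M_t's have disjoint
   supports, then, as all the A_t :|: B_t have the same size, each factor must
   receive exactly the pair that the previous one produced, so the indices are
   consecutive mod p.  For a word w of length strictly between 0 and p this fails
   for w ++ w; hence any two rows of P^2 have a common positive column, and the
   powers of P contract to a rank one matrix. *)
Require Import Defs.
From HB Require Import structures.
From mathcomp Require Import all_boot all_order all_algebra.
From mathcomp Require Import all_classical all_reals all_analysis.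
From mathcomp Require Import fintype finset zify ring lra.
Set Implicit Arguments. Unset Strict Implicit. Unset Printing Implicit Defensive.
Import Order.TTheory GRing.Theory Num.Theory.
Import numFieldNormedType.Exports.
Local Open Scope ring_scope.

(** * Closure properties and positive entries of stochastic matrices *)

Section Stochastic.
Variables (R : numDomainType) (n : nat).
Implicit Types (A B P : 'M[R]_n) (s : seq 'M[R]_n).

Lemma stochastic1 : stochastic (1%:M : 'M[R]_n).
Proof.
split=> [i j|i]; first by rewrite mxE ler0n.
rewrite (bigD1 i) //= mxE eqxx big1 ?addr0 // => j ji.
by rewrite mxE eq_sym (negbTE ji).
Qed.

Lemma stochastic_mul A B : stochastic A -> stochastic B -> stochastic (A *m B).
Proof.
move=> [A0 A1] [B0 B1]; split=> [i j|i].
  by rewrite mxE sumr_ge0 // => k _; rewrite mulr_ge0.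
under eq_bigr do rewrite mxE.
rewrite exchange_big /= -(A1 i); apply: eq_bigr => k _.
by rewrite -mulr_sumr B1 mulr1.
Qed.

Lemma stochastic_prod s :
  (forall A, A \in s -> stochastic A) -> stochastic (mxprod s).
Proof.
elim: s => [|A s IH] sP /=; first exact: stochastic1.
apply: stochastic_mul; first by apply: sP; rewrite mem_head.
by apply: IH => B Bs; apply: sP; rewrite inE Bs orbT.
Qed.

Lemma mxprod_cat s1 s2 : mxprod (s1 ++ s2) = mxprod s1 *m mxprod s2.
Proof. by elim: s1 => [|A s1 IH] /=; rewrite ?mul1mx // IH mulmxA. Qed.

Lemma mxpowS P k : mxpow P k.+1 = P *m mxpow P k.
Proof. by []. Qed.

Lemma mxpowD P k l : mxpow P (k + l) = mxpow P k *m mxpow P l.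
Proof. by elim: k => [|k IH]; rewrite ?mul1mx // addSn !mxpowS IH mulmxA. Qed.

Lemma stochastic_pow P k : stochastic P -> stochastic (mxpow P k).
Proof.
move=> sP; elim: k => [|k IH]; first exact: stochastic1.
exact: stochastic_mul.
Qed.

Lemma stochastic_pos A i : stochastic A -> exists j, 0 < A i j.
Proof.
move=> [A0 A1]; apply/existsP; apply: contraT; rewrite negb_exists => /forallP Ai.
suff /eqP : \sum_j A i j = 0 by rewrite A1 oner_eq0.
rewrite big1 // => j _; apply/eqP; move: (Ai j).
by rewrite lt_def A0 andbT negbK.
Qed.

Lemma mulmx_pos A B i k j : stochastic A -> stochastic B ->
  0 < A i k -> 0 < B k j -> 0 < (A *m B) i j.
Proof.
move=> [A0 _] [B0 _] Ak Bk; rewrite mxE (bigD1 k) //=.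
by rewrite ltr_wpDr ?mulr_gt0 // sumr_ge0 // => l _; rewrite mulr_ge0.
Qed.

End Stochastic.

(** * Contraction by scrambling matrices and convergence of powers *)

Section Convergence.
Variables (R : realType) (n : nat).
Implicit Types (P Q V : 'M[R]_n).
Local Open Scope classical_set_scope.

Definition scrambling Q := forall x y, exists j, 0 < Q x j /\ 0 < Q y j.

Lemma stochastic_average_bound Q V c d i j : stochastic Q ->
  (forall k, c <= V k j <= d) -> c <= (Q *m V) i j <= d.
Proof.
move=> [Q0 Q1] Vcd; rewrite mxE -[c]mul1r -[d]mul1r -(Q1 i) !mulr_suml.
by apply/andP; split; apply: ler_sum => k _; apply: ler_wpM2l => //;
  case/andP: (Vcd k).
Qed.

(** Two rows of [Q] share at least the mass [d > 0], their entrywise minimum. The shared part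
    cancels in the difference, so only mass at most [1 - d] of each row can see the oscillation
    [w]. *)
Lemma scrambling_contracts Q : stochastic Q -> scrambling Q ->
  exists2 r : R, 0 <= r < 1 & forall V j w,
    (forall x y, V x j - V y j <= w) ->
    forall x y, (Q *m V) x j - (Q *m V) y j <= r * w.
Proof.
move=> [Q0 Q1] scrQ.
pose ov (z : 'I_n * 'I_n) := \sum_k Num.min (Q z.1 k) (Q z.2 k).
(* The default 1 of the minimum gives [d <= 1], hence a factor [1 - d] that is nonnegative. *)
pose d := \big[Num.min/1]_z ov z.
have ovd z : d <= ov z by exact: bigmin_le.
have d0 : 0 < d.
  apply: lt_bigmin => // -[x y] _; have [k [xk yk]] := scrQ x y.
  rewrite /ov (bigD1 k) //= ltr_wpDr ?lt_min ?xk //.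
  by apply: sumr_ge0 => l _; rewrite le_min !Q0.
have d1 : d <= 1 by exact: bigmin_le_id.
exists (1 - d) => [|V j w Vw x y]; first by apply/andP; split; lra.
have w0 : 0 <= w by have := Vw x x; rewrite subrr.
have [z zmin] : exists z, forall k, V z j <= V k j.
  by case: (@arg_minP _ _ _ x xpredT (fun k => V k j)) => // z _ zP;
    exists z => k; exact: zP.
set c := V z j in zmin.
pose m k := Num.min (Q x k) (Q y k).
(* Column [j] is measured from its minimum [c]. The middle sum is the same for rows [x] and [y]; the
   first is at most [(1 - d) * w] for [x] and at least 0 for [y]. *)
have shift i : (Q *m V) i j = \sum_k (Q i k - m k) * (V k j - c)
    + \sum_k m k * (V k j - c) + c.
  rewrite -big_split /= mxE -[X in _ + X]mul1r -(Q1 i) mulr_suml -big_split /=.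
  by apply: eq_bigr => k _; ring.
rewrite (shift x) (shift y).
have up : \sum_k (Q x k - m k) * (V k j - c) <= (1 - d) * w.
  apply: (@le_trans _ _ (\sum_k (Q x k - m k) * w)).
    apply: ler_sum => k _; apply: ler_wpM2l; last exact: Vw.
    by rewrite subr_ge0 ge_min lexx.
  rewrite -mulr_suml sumrB Q1 ler_wpM2r //.
  by have := ovd (x, y); rewrite /ov /m /=; lra.
have lo : 0 <= \sum_k (Q y k - m k) * (V k j - c).
  apply: sumr_ge0 => k _; apply: mulr_ge0; rewrite subr_ge0 ?zmin //.
  by rewrite ge_min lexx orbT.
by lra.
Qed.

Lemma stochastic_limit P (L : 'M[R]_n) : stochastic P ->
  (forall i j, (fun k => mxpow P k i j) @ \oo --> L i j) ->
  forall i, \sum_j L i j = 1.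
Proof.
move=> sP cvL i.
have cvS : (fun k => \sum_j mxpow P k i j) @ \oo --> \sum_j L i j.
  by apply: cvg_big => [|j _]; [exact: add_continuous|exact: cvL].
have E : (fun k => \sum_j mxpow P k i j) = cst 1.
  by apply/funext => k; case: (stochastic_pow k sP) => _ ->.
rewrite E in cvS; apply: (cvg_unique (@norm_hausdorff _ R) cvS).
exact: cvg_cst.
Qed.

(** The columns of [P^(k m)] oscillate by at most [r^k], and every later power averages these
    columns. So each column is Cauchy with the same limit in all rows, and row sums 1 keep that
    limit matrix nonzero. *)
Lemma scrambling_powers_converge P m : (0 < n)%N -> stochastic P ->
  scrambling (mxpow P m) -> powers_converge_rank_one P.
Proof.
move=> n0 sP scr; pose o := Ordinal n0.
have [r /andP[r0 r1] contr] := scrambling_contracts (stochastic_pow m sP) scr.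
have osc k x y j : mxpow P (k * m) x j - mxpow P (k * m) y j <= r ^+ k.
  elim: k x y => [|k IH] x y.
    by rewrite mul0n /= !mxE expr0; do 2 case: (_ == _) => /=; lra.
  by rewrite mulSn mxpowD exprS; apply: contr.
have close k l i j : (k * m <= l)%N ->
    `|mxpow P l i j - mxpow P (k * m) o j| <= r ^+ k.
  move=> kl; rewrite -(subnK kl) mxpowD ler_distl.
  apply: stochastic_average_bound; first exact: stochastic_pow.
  by move=> x; have := osc k x o j; have := osc k o x j; lra.
have small (e : R) : 0 < e -> exists k, r ^+ k < e.
  move=> e0; have /cvgrPdist_lt/(_ e e0) : (fun k => r ^+ k) @ \oo --> (0 : R).
    by apply: cvg_expr; rewrite ger0_norm.
  move=> [k _ /(_ k (leqnn k))] /=; rewrite sub0r normrN ger0_norm ?exprn_ge0 //.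
  by exists k.
(* Row [o] serves as reference; by [close] the other rows have the same limit. *)
have cv j : cvg ((fun k => mxpow P k o j) @ \oo).
  apply/cauchy_cvgP/cauchy_exP => e e0; have [k ke] := small e e0.
  exists (mxpow P (k * m) o j), (k * m)%N => // l /= kl.
  by rewrite -ball_normE /ball_ /= distrC (le_lt_trans (close k l o j kl)).
pose L : 'M[R]_n := \matrix_(i, j) lim ((fun k => mxpow P k o j) @ \oo).
have cvL i j : (fun k => mxpow P k i j) @ \oo --> L i j.
  rewrite mxE; apply/cvgrPdist_lt => e e0.
  have e3 : 0 < e / 3 by lra.
  have [k ke] := small _ e3.
  have /cvgrPdist_lt/(_ _ e3) [N _ NP] := cv j.
  exists (maxn N (k * m)) => // l /=; rewrite geq_max => /andP[Nl kl].
  have := NP l Nl; have := close k l i j kl; have := close k l o j kl.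
  rewrite /= !ler_norml !ltr_norml; lra.
exists L; split; last exact: cvL.
apply/eqP; rewrite eqn_leq; apply/andP; split.
  suff -> : L = (const_mx 1 : 'cV_n) *m row o L by rewrite mulmx_max_rank.
  by apply/matrixP => i j; rewrite !mxE big_ord1 !mxE mul1r.
rewrite lt0n mxrank_eq0; apply/eqP => L0.
have := stochastic_limit sP cvL o; rewrite L0.
by under eq_bigr do rewrite mxE; rewrite big1 // => /eqP; rewrite eq_sym oner_eq0.
Qed.

End Convergence.

(** * Two disjoint closed sets as an obstruction to a rank one limit *)

Section ClosedSets.
Variables (R : realType) (n : nat).
Implicit Types P Q : 'M[R]_n.

Definition supports P (A B : {set 'I_n}) :=
  forall i j, i \in A -> j \notin B -> P i j = 0.

Lemma supports_mul P Q A B C :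
  supports P A B -> supports Q B C -> supports (P *m Q) A C.
Proof.
move=> PAB QBC i j iA jC; rewrite mxE big1 // => k _.
by have [kB|kB] := boolP (k \in B); [rewrite QBC ?mulr0|rewrite PAB ?mul0r].
Qed.

Lemma supports_pow P A k : supports P A A -> supports (mxpow P k) A A.
Proof.
move=> PA; elim: k => [|k IH]; last exact: supports_mul IH.
by move=> i j iA; rewrite mxE; case: eqP => // <-; rewrite iA.
Qed.

(** A limit [L = u v] would keep both sets closed. Row [a] has a nonzero entry in some column [j] of
    [A], so [v j] is nonzero; row [b] is nonzero, so [u b] is too. Then [L b j] is nonzero, although
    [j] lies outside [B]. *)
Lemma two_closed_sets_not_rank_one P (A B : {set 'I_n}) a b :
  stochastic P -> a \in A -> b \in B -> [disjoint A & B] ->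
  supports P A A -> supports P B B -> ~ powers_converge_rank_one P.
Proof.
move=> sP aA bB dAB PA PB [L [rkL cvL]].
have L1 := stochastic_limit sP cvL.
have L0 C : supports P C C -> supports L C C.
  move=> PC i j iC jC; apply: (cvg_unique (@norm_hausdorff _ R) (cvL i j)).
  rewrite (_ : (fun k => _) = cst 0); first exact: cvg_cst.
  by apply/funext => k; exact: (supports_pow k PC iC jC).
have [u [v Luv]] : exists (u : 'I_n -> R) v, forall i j, L i j = u i * v j.
  have := mulmx_base L; move: (col_base L) (row_base L); rewrite rkL => u v uv.
  by exists (u ^~ 0), (v 0) => i j; rewrite -uv mxE big_ord1.
have nz i : exists j, L i j != 0.
  apply/existsP; apply: contraT; rewrite negb_exists => /forallP Li.
  have := L1 i; rewrite big1 => [/eqP|j _]; first by rewrite eq_sym oner_eq0.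
  by apply/eqP; have := Li j; rewrite negbK.
have [j Laj] := nz a; have [l Lbl] := nz b.
have jA : j \in A by apply: contraNT Laj => jA; rewrite (L0 A PA).
have jB : j \notin B by rewrite (disjointFr dAB).
have := L0 B PB b j bB jB; rewrite Luv => /eqP; rewrite mulf_eq0.
move: Laj Lbl; rewrite !Luv !mulf_eq0 !negb_or.
by move=> /andP[_ /negbTE->] /andP[/negbTE->].
Qed.

End ClosedSets.

(** * The matrices moving one pair of sets onto another *)

Section Transfer.
Variables (R : realType) (n : nat).
Local Notation pair := ({set 'I_n} * {set 'I_n})%type.
Implicit Types (A B X Y : {set 'I_n}) (c d : pair) (P : 'M[R]_n).

Definition target c d (i : 'I_n) : {set 'I_n} :=
  if i \in c.1 then d.1 else if i \in c.2 then d.2 else [set: 'I_n].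

Definition transfer c d : 'M[R]_n :=
  \matrix_(i, j) ((j \in target c d i)%:R / #|target c d i|%:R).

Definition good c := [/\ c.1 != set0, c.2 != set0 & [disjoint c.1 & c.2]].

Lemma target_neq0 c d i : good d -> target c d i != set0.
Proof.
move=> [d1 d2 _]; rewrite /target; do 2?case: ifP => _ //.
by apply/set0Pn; exists i; rewrite inE.
Qed.

Lemma transfer_gt0 c d i j : (0 < transfer c d i j) = (j \in target c d i).
Proof.
rewrite mxE; case: (boolP (j \in _)) => jT; last by rewrite mul0r ltxx.
by rewrite mul1r invr_gt0 ltr0n (cardD1 j) jT.
Qed.

Lemma stochastic_transfer c d : good d -> stochastic (transfer c d).
Proof.
move=> gd; split=> [i j|i]; first by rewrite mxE divr_ge0 ?ler0n.
under eq_bigr do rewrite mxE.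
rewrite -mulr_suml -natr_sum -big_mkcond /= sum1_card divff //.
by rewrite pnatr_eq0 cards_eq0 target_neq0.
Qed.

Lemma supports_transfer c d : [disjoint c.1 & c.2] ->
  supports (transfer c d) c.1 d.1 /\ supports (transfer c d) c.2 d.2.
Proof.
move=> dc; split=> i j ic jd; rewrite mxE /target.
  by rewrite ic (negbTE jd) mul0r.
by rewrite (disjointFl dc ic) ic (negbTE jd) mul0r.
Qed.

Definition separated P X Y :=
  forall x y j, x \in X -> y \in Y -> ~ (0 < P x j /\ 0 < P y j).

Definition below c d := (c.1 \subset d.1) && (c.2 \subset d.2).

(* A row outside [c.1 :|: c.2] reaches every state, so a separated pair of sets
   must be split by [c]; after the step it has been enlarged to [d]. *)
Lemma separated_transfer c d P X Y : good c -> good d -> stochastic P ->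
  X != set0 -> Y != set0 -> separated (transfer c d *m P) X Y ->
  (below (X, Y) c \/ below (Y, X) c) /\ separated P d.1 d.2.
Proof.
move=> [c1 c2 dc] gd sP /set0Pn[x0 x0X] /set0Pn[y0 y0Y] sep.
have sM := stochastic_transfer c gd.
have sepT x y x' y' j : x \in X -> y \in Y -> x' \in target c d x ->
    y' \in target c d y -> ~ (0 < P x' j /\ 0 < P y' j).
  move=> xX yY xt yt [Px Py]; apply: (sep x y j xX yY).
  by split; [apply: (mulmx_pos (k := x'))|apply: (mulmx_pos (k := y'))];
    rewrite ?transfer_gt0.
have noI x y z : x \in X -> y \in Y -> z \in target c d x ->
    z \in target c d y -> False.
  move=> xX yY zx zy; have [j Pj] := stochastic_pos z sP.
  by apply: (sepT x y z z j).
(* In every other case the two targets meet: they coincide if [x] and [y] share a block, and one of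
   them is the full set if [x] or [y] is in no block. *)
have split x y : x \in X -> y \in Y ->
    (x \in c.1) && (y \in c.2) || (x \in c.2) && (y \in c.1).
  move=> xX yY; have [zx zxP] := set0Pn _ (target_neq0 c x gd).
  have [zy zyP] := set0Pn _ (target_neq0 c y gd).
  have := noI x y zx xX yY zxP; have := noI x y zy xX yY ^~ zyP.
  move: zxP zyP; rewrite /target.
  case: (boolP (x \in c.1)) => x1; case: (boolP (y \in c.1)) => y1;
    case: (boolP (x \in c.2)) => x2; case: (boolP (y \in c.2)) => y2 //=;
    rewrite ?inE => zx' zy' H1 H2;
    by [case: (H1 isT)|case: (H2 isT)|case: (H1 zy')|case: (H2 zx')].
have nc12 z : z \in c.1 -> z \in c.2 -> False.
  by move=> z1; rewrite (disjointFr dc z1).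
have := split _ _ x0X y0Y => /orP[|] /andP[x0c y0c]; split.
- left; apply/andP; split; apply/subsetP => z zZ.
  + by case/orP: (split _ _ zZ y0Y) => /andP[// _ /nc12]; case/(_ y0c).
  + by case/orP: (split _ _ x0X zZ) => /andP[// /nc12]; case/(_ x0c).
- move=> x y j xd yd; apply: (sepT x0 y0) => //; rewrite /target ?x0c //.
  by rewrite (disjointFl dc y0c) y0c.
- right; apply/andP; split; apply/subsetP => z zZ.
  + by case/orP: (split _ _ x0X zZ) => /andP[// /nc12]; case/(_ x0c).
  + by case/orP: (split _ _ zZ y0Y) => /andP[// _ /nc12]; case/(_ y0c).
- move=> x y j xd yd [Px Py]; apply: (sepT x0 y0 y x j) => //; rewrite /target ?y0c //.
  by rewrite (disjointFl dc x0c) x0c.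
Qed.

End Transfer.

(** * Words in the matrices of a cyclic sequence of pairs *)

Section Cycle.
Variables (R : realType) (n p : nat) (c : nat -> {set 'I_n} * {set 'I_n}).
Hypothesis p_gt0 : (0 < p)%N.
Hypothesis c_good : forall t, (t < p)%N -> good (c t).
(** Comparison is made in both orders because the pairs stand for unordered ones. *)
Hypothesis c_antichain : forall t u, (t < p)%N -> (u < p)%N ->
  below (c t) (c u) \/ below ((c t).2, (c t).1) (c u) -> t = u.

Definition cycle_mx t : 'M[R]_n := transfer R (c t) (c (t.+1 %% p)).

Lemma stochastic_cycle_mx t : stochastic (cycle_mx t).
Proof. by apply: stochastic_transfer; apply: c_good; rewrite ltn_mod. Qed.

Lemma stochastic_cycle_word w : stochastic (mxprod [seq cycle_mx t | t <- w]).
Proof. by apply: stochastic_prod => A /mapP[t _ ->]; exact: stochastic_cycle_mx. Qed.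

(** The first letter must have a pair containing [c t], so it is [t] by the antichain hypothesis;
    the rest of the word then separates the next pair of the cycle, and induction applies. *)
Lemma separated_word w t : (t < p)%N -> all (gtn p) w ->
  separated (mxprod [seq cycle_mx u | u <- w]) (c t).1 (c t).2 ->
  forall m, (m < size w)%N -> nth 0%N w m = ((t + m) %% p)%N.
Proof.
elim: w t => [//|u w IH] t tp /= /andP[up wp] sep.
have [ct1 ct2 _] := c_good tp.
have gS v : good (c (v.+1 %% p)) by apply: c_good; rewrite ltn_mod.
have [bl sepw] := separated_transfer (c_good up) (gS u)
  (stochastic_cycle_word w) ct1 ct2 sep.
have tu : t = u := c_antichain tp up bl.
case=> [|m] mw; first by rewrite addn0 /= modn_small -?tu.
by rewrite /= (IH (u.+1 %% p)%N) ?ltn_mod // modnDml tu addSnnS.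
Qed.

(** Otherwise the letters of [w ++ w] increase by one modulo [p]. The first letter recurs after
    [size w] steps, so [p] would divide [size w]. *)
Lemma short_word_scrambling w : all (gtn p) w -> (0 < size w < p)%N ->
  scrambling (mxprod [seq cycle_mx t | t <- w ++ w]).
Proof.
case: w => [//|t w] /= /andP[tp wp] wltp x y; apply: contrapT => nscr.
have gS : good (c (t.+1 %% p)) by apply: c_good; rewrite ltn_mod.
have sep : separated (mxprod [seq cycle_mx u | u <- (t :: w) ++ t :: w])
    [set x] [set y].
  by move=> _ _ j /set1P-> /set1P-> Hj; apply: nscr; exists j.
have n0 (z : 'I_n) : [set z] != set0 by apply/set0Pn; exists z; rewrite inE.
(* Singletons need not form a pair of the cycle; peeling off the first letter [t] replaces them by
   the pair of index [t + 1]. *)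
have [_ sepw] := separated_transfer (c_good tp) gS
  (stochastic_cycle_word (w ++ t :: w)) (n0 x) (n0 y) sep.
have wwp : all (gtn p) (w ++ t :: w) by rewrite all_cat /= wp tp.
(* In the remaining word, position [size w] holds the [t] that begins the second copy. *)
have := separated_word (ltn_pmod t.+1 p_gt0) wwp sepw (m := size w).
rewrite size_cat /= addnS ltnS leq_addr nth_cat ltnn subnn /= => /(_ isT).
rewrite modnDml addSnnS -{1}(modn_small tp) -{1}[t]addn0 => /eqP.
by rewrite eqn_modDl mod0n modn_small.
Qed.

Lemma supports_cycle_word m t : (t + m <= p)%N -> (t < p)%N ->
  let P := mxprod [seq cycle_mx u | u <- iota t m] in
  supports P (c t).1 (c ((t + m) %% p)).1 /\
  supports P (c t).2 (c ((t + m) %% p)).2.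
Proof.
elim: m t => [|m IH] t tmp tp /=.
  by rewrite addn0 modn_small //; split=> i j ic; rewrite mxE;
    case: eqP => // <-; rewrite ic.
have [_ _ dt] := c_good tp.
have [s1 s2] := supports_transfer R (c (t.+1 %% p)) dt.
rewrite -addSnnS in tmp *.
case: (ltnP t.+1 p) => tp'.
  have [w1 w2] := IH t.+1 tmp tp'; rewrite modn_small // in s1 s2.
  by rewrite /cycle_mx modn_small //; split; apply: supports_mul; eauto.
(* Here [t + 1 = p]: the last letter leads back to the pair of index 0. *)
have m0 : m = 0%N by apply/eqP; rewrite -leqn0 -(leq_add2l t.+1) addn0 (leq_trans tmp).
by rewrite m0 addn0 /= mulmx1; split.
Qed.

Lemma cycle_not_rank_one :
  ~ powers_converge_rank_one (mxprod [seq cycle_mx t | t <- iota 0 p]).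
Proof.
have [/set0Pn[a aA] /set0Pn[b bB] dAB] := c_good p_gt0.
have := supports_cycle_word (t := 0) (leqnn p) p_gt0; rewrite add0n modnn => -[sA sB].
exact: (two_closed_sets_not_rank_one (stochastic_cycle_word _) aA bB).
Qed.

Lemma short_word_rank_one w : all (gtn p) w -> (0 < size w < p)%N ->
  powers_converge_rank_one (mxprod [seq cycle_mx t | t <- w]).
Proof.
move=> wp sw; have [/set0Pn[[i ni] _] _ _] := c_good p_gt0.
apply: (scrambling_powers_converge (m := 2)); first exact: leq_ltn_trans ni.
  exact: stochastic_cycle_word.
have -> : mxpow (mxprod [seq cycle_mx t | t <- w]) 2 =
    mxprod [seq cycle_mx t | t <- w ++ w].
  by rewrite map_cat mxprod_cat !mxpowS /= mulmx1.
exact: short_word_scrambling.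
Qed.

End Cycle.

(** * Counting and comparing the splittings of sets of fixed size *)

Section Splittings.
Variables (T : finType) (x0 : T) (m : nat).
Hypothesis m_gt0 : (0 < m)%N.

Definition base (U : {set T}) := odflt x0 [pick x in U].

Lemma base_in (U : {set T}) : #|U| = m -> base U \in U.
Proof.
move=> Um; rewrite /base; case: pickP => //= U0.
by move: m_gt0; rewrite -Um (eq_card0 U0).
Qed.

(* [(U, B)] encodes the unordered splitting [{U :\: B, B}] of [U]: of its two
   blocks, [B] is the one without the base point. *)
Definition splittings : {set {set T} * {set T}} :=
  [set z : {set T} * {set T} | (#|z.1| == m) && (z.2 \in powerset (z.1 :\ base z.1) :\ set0)].

Definition blocks (z : {set T} * {set T}) := (z.1 :\: z.2, z.2).

(** After [U] is chosen, [B] ranges over the nonempty subsets of the [m - 1] points other than the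
    base point. *)
Lemma card_splittings : #|splittings| = ('C(#|T|, m) * (2 ^ (m - 1) - 1))%N.
Proof.
rewrite -sum1_card.
transitivity (\sum_(U : {set T} | #|U| == m)
  \sum_(B in powerset (U :\ base U) :\ set0) 1)%N.
  by rewrite pair_big_dep; apply: eq_bigl => z; rewrite inE.
rewrite (eq_bigr (fun=> (2 ^ (m - 1) - 1)%N)) => [|U /eqP Um].
  rewrite sum_nat_const -card_draws; congr (_ * _)%N.
  by apply: eq_card => U; rewrite !inE.
have := cardsD1 (base U) U; rewrite base_in // Um add1n => ->.
have := cardsD1 set0 (powerset (U :\ base U)).
by rewrite sum1_card card_powerset inE sub0set subn1 subn1 /= => ->.
Qed.

Lemma splittingsP z : z \in splittings ->
  [/\ #|z.1| = m, z.2 \subset z.1, base z.1 \in z.1 :\: z.2 & z.2 != set0].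
Proof.
rewrite !inE => /and3P[/eqP zm z2 /subsetD1P[sz bz]].
by split=> //; rewrite bz base_in.
Qed.

Lemma blocks_good z : z \in splittings ->
  [/\ (blocks z).1 != set0, (blocks z).2 != set0
    & [disjoint (blocks z).1 & (blocks z).2]].
Proof.
move=> /splittingsP[_ _ bz z2]; split=> //=; first by apply/set0Pn; exists (base z.1).
by rewrite -setI_eq0 setDE -setIA [~: _ :&: _]setIC setICr setI0.
Qed.

(** Either inclusion puts one union inside the other, and equal sizes make the unions equal. Blocks
    in the same order then coincide by complementation. *)
Lemma blocks_antichain y z : y \in splittings -> z \in splittings ->
  ((blocks y).1 \subset (blocks z).1) && ((blocks y).2 \subset (blocks z).2) \/
  ((blocks y).2 \subset (blocks z).1) && ((blocks y).1 \subset (blocks z).2) ->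
  y = z.
Proof.
move: y z => [U B] [V C] /splittingsP[/= Um BU bB _] /splittingsP[/= Vm CV bC _] H.
have UV : U = V.
  apply/eqP; rewrite eqEcard Um Vm leqnn andbT -(setID U B) subUset (setIidPr BU).
  case: H => /andP[s1 s2].
    by rewrite (subset_trans s2 CV) (subset_trans s1 (subsetDl _ _)).
  by rewrite (subset_trans s1 (subsetDl _ _)) (subset_trans s2 CV).
subst V; case: H => /andP[s1 s2].
  congr pair; apply/eqP; rewrite eqEsubset s2 andTb; apply/subsetP => x xC.
  apply: contraT => xB; have := subsetP s1 x.
  by rewrite !inE xB xC (subsetP CV) // => /(_ isT).
(* In the swapped order the common base point would fall into [C], the block that avoids it. *)
by have := subsetP s2 _ bB; move: bC; rewrite inE => /andP[/negbTE->].
Qed.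

End Splittings.

(** * The cycle through all splittings of sets of [n - n %/ 3] states *)

Theorem theorem5 (R : realType) (n : nat) :
  (2 <= n)%N ->
  exists Sigma : 'M[R]_n -> Prop,
    (forall A, Sigma A -> stochastic A) /\
    (exists s : seq 'M[R]_n,
        (forall A, A \in s -> Sigma A) /\ size s = pstar n /\
        ~ powers_converge_rank_one (mxprod s)) /\
    (forall s : seq 'M[R]_n,
        (forall A, A \in s -> Sigma A) ->
        (1 <= size s)%N -> (size s <= pstar n - 1)%N ->
        powers_converge_rank_one (mxprod s)).
Proof.
move=> n2; pose o : 'I_n := Ordinal (ltnW n2).
pose m := (n - n %/ 3)%N.
have m2 : (1 < m)%N by rewrite /m; lia.
have m0 : (0 < m)%N := ltnW m2.
pose S := splittings o m; pose p := #|S|.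
have pE : p = pstar n.
  (* The symmetry of binomial coefficients turns [n - n %/ 3] into [n %/ 3]. *)
  by rewrite /p card_splittings // card_ord /pstar bin_sub // leq_div.
have p0 : (0 < p)%N.
  rewrite pE /pstar muln_gt0 bin_gt0 leq_div //= subn_gt0.
  by rewrite -[1%N](expn0 2) ltn_exp2l // subn_gt0.
pose z t := nth (set0, set0) (enum S) t.
pose c t := blocks (z t).
have zS t : (t < p)%N -> z t \in S.
  by move=> tp; rewrite -mem_enum mem_nth // -cardE.
have cg t : (t < p)%N -> good (c t) by move=> tp; apply: blocks_good (zS t tp).
have ca t u : (t < p)%N -> (u < p)%N ->
    below (c t) (c u) \/ below ((c t).2, (c t).1) (c u) -> t = u.
  move=> tp up /(blocks_antichain m0 (zS t tp) (zS u up)) /eqP.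
  (* The enumeration has no repetition, so equal splittings have equal indices. *)
  by rewrite nth_uniq ?enum_uniq -?cardE // => /eqP.
exists (fun A => exists2 t, (t < p)%N & A = cycle_mx R p c t).
split=> [A [t _ ->]|]; first exact: stochastic_cycle_mx.
split.
  exists [seq cycle_mx R p c t | t <- iota 0 p]; split=> [A /mapP[t]|].
    by rewrite mem_iota => /andP[_ tp] ->; exists t.
  by rewrite size_map size_iota; split=> //; exact: cycle_not_rank_one.
move=> s sS s1 sp.
have [w wp ws] : exists2 w, all (gtn p) w & s = [seq cycle_mx R p c t | t <- w].
  elim: s sS {s1 sp} => [|A s IH] sS; first by exists [::].
  have [t tp ->] := sS A (mem_head _ _).
  have [B Bs|w wp ->] := IH; first by apply: sS; rewrite inE Bs orbT.
  by exists (t :: w); rewrite //= tp.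
rewrite ws in s1 sp *; rewrite size_map in s1 sp.
apply: short_word_rank_one => //.
by rewrite s1 -[p]prednK // ltnS -subn1 pE.
Qed.
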